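(* Let $x:\Sigma\to\mathbb{I}^3$ be a minimal conformal immersion (mean curvature $H\equiv0$) of a simply connected domain $\Sigma\subset\mathbb{C}$, with orientation such that it admits an adapted frame in $\mathrm{SU}(1,0,1)$ (as defined in the context). Then locally, in the coordinates $(\mathbf{l},\mathbf{x},\mathbf{y})$ of $\mathbb{I}^3$ and up to a constant of integration, $x$ can be represented as $$x=\operatorname{Re}\int(h,\,1,\,-i)\,\omega$$ for some meromorphic function $h:\Sigma\to\mathbb{C}$ and holomorphic $1$-form $\omega$ such that $h^2\omega$ is holomorphic. The metric of $x$ is then $$\mathrm{d}s^2=|\omega|^2,$$ the Hopf differential of $x$ is $$\tfrac12\,\omega\,\mathrm{d}h,$$ and the lightlike Gauss map $g:\Sigma\to\mathcal{L}$ of $x$ is $$g=-\tfrac12\left(1+|h|^2,\;2\operatorname{Re}h,\;-2\operatorname{Im}h,\;-1+|h|^2\right)^t.$$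
   Context: All maps are smooth. $\mathbb{L}^4$ is $\mathbb{R}^4$ with $\langle x,y\rangle=-x_0y_0+x_1y_1+x_2y_2+x_3y_3$, and $\mathcal{L}=\{y\in\mathbb{L}^4:\langle y,y\rangle=0\}$. With $\mathfrak{p}=(1,0,0,1)^t$, isotropic $3$-space is $\mathbb{I}^3=\{x\in\mathbb{L}^4:\langle x,\mathfrak{p}\rangle=0\}=\{(\mathbf{l},\mathbf{x},\mathbf{y},\mathbf{l})^t\}$ with induced metric $\mathrm{d}\mathbf{x}^2+\mathrm{d}\mathbf{y}^2$; a point $(\mathbf{l},\mathbf{x},\mathbf{y},\mathbf{l})^t$ is also written $(\mathbf{l},\mathbf{x},\mathbf{y})$. $\mathbb{L}^4$ is identified with $2\times2$ Hermitian matrices by $x\sim X=\begin{pmatrix}x_0+x_3&x_1+ix_2\\ x_1-ix_2&x_0-x_3\end{pmatrix}$. A conformal immersion $x:\Sigma\to\mathbb{I}^3$, with complex coordinate $z=u+iv$ on $\Sigma$, is an immersion whose induced metric is Riemannian and equals $e^{2\sigma}(\mathrm{d}u^2+\mathrm{d}v^2)=e^{2\sigma}\mathrm{d}z\,\mathrm{d}\bar z$ for some $\sigma:\Sigma\to\mathbb{R}$. Its lightlike Gauss map is the unique $g:\Sigma\to\mathcal{L}$ with $\langle g,\mathfrak{p}\rangle=1$ and $\langle\mathrm{d}x,g\rangle=0$. With $\partial_z=\tfrac12(\partial_u-i\partial_v)$, $\partial_{\bar z}=\tfrac12(\partial_u+i\partial_v)$, its mean curvature is $H=2e^{-2\sigma}\langle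 x_{z\bar z},g\rangle$ and its Hopf differential is the quadratic differential $\langle x_{zz},g\rangle\,\mathrm{d}z^2$. If $\omega=\phi\,\mathrm{d}z$, then $|\omega|^2=|\phi|^2\mathrm{d}z\,\mathrm{d}\bar z$ and $\omega\,\mathrm{d}h=\phi h_z\,\mathrm{d}z^2$. $\mathrm{SU}(1,0,1)=\left\{\begin{pmatrix}e^{i\theta}&w\\0&e^{-i\theta}\end{pmatrix}:\theta\in\mathbb{R},\,w\in\mathbb{C}\right\}$. An adapted frame of a conformal immersion (with matrix form $X$) is a map $F:\Sigma\to\mathrm{SU}(1,0,1)$ with $X_u=e^{\sigma}FE_1F^*$ and $X_v=e^{\sigma}FE_2F^*$, where $E_1=\begin{pmatrix}0&1\\1&0\end{pmatrix}$, $E_2=\begin{pmatrix}0&i\\-i&0\end{pmatrix}$ and $F^*$ is the conjugate transpose. (Having one means that $\mathbf{x}+i\mathbf{y}$ is holomorphic in $z$ along the immersion.) *)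

(* Defs.v *)
From Stdlib Require Import Reals.
From Coquelicot Require Import Coquelicot.
Open Scope R_scope.

(** Maps on a domain [Sigma : C -> Prop] of the z-plane are total functions on
    Coquelicot's [C = R * R]; only their values on the open set [Sigma]
    matter.  A point is [z = (u, v)], i.e. [z = u + iv]. *)

(** * Domains *)

Definition unit_interval (t : R) : Prop := 0 <= t <= 1.
Definition unit_square (st : R * R) : Prop :=
  unit_interval (fst st) /\ unit_interval (snd st).

Definition path_in (Sigma : C -> Prop) (gamma : R -> C) : Prop :=
  continuous_on unit_interval gamma /\
  forall t, unit_interval t -> Sigma (gamma t).

Definition path_connected (Sigma : C -> Prop) : Prop :=
  forall p q, Sigma p -> Sigma q ->
    exists gamma, path_in Sigma gamma /\ gamma 0 = p /\ gamma 1 = q.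

Definition null_homotopic_in (Sigma : C -> Prop) (gamma : R -> C) : Prop :=
  exists K : R * R -> C,
    continuous_on unit_square K /\
    (forall st, unit_square st -> Sigma (K st)) /\
    (forall t, unit_interval t -> K (0, t) = gamma t) /\
    (forall t, unit_interval t -> K (1, t) = gamma 0) /\
    (forall s, unit_interval s -> K (s, 0) = gamma 0 /\ K (s, 1) = gamma 0).

Definition simply_connected_domain (Sigma : C -> Prop) : Prop :=
  open Sigma /\ (exists p, Sigma p) /\ path_connected Sigma /\
  (forall gamma, path_in Sigma gamma -> gamma 0 = gamma 1 ->
    null_homotopic_in Sigma gamma).

(** * Derivatives and smoothness *)

Definition d_u (f : C -> R) (p : C) : R := Derive (fun t => f (t, Im p)) (Re p).
Definition d_v (f : C -> R) (p : C) : R := Derive (fun t => f (Re p, t)) (Im p).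

Definition dC_u (f : C -> C) (p : C) : C :=
  (d_u (fun q => Re (f q)) p, d_u (fun q => Im (f q)) p).
Definition dC_v (f : C -> C) (p : C) : C :=
  (d_v (fun q => Re (f q)) p, d_v (fun q => Im (f q)) p).

Definition d_z (f : C -> C) (p : C) : C :=
  (/ 2 * (dC_u f p - Ci * dC_v f p))%C.
Definition d_zbar (f : C -> C) (p : C) : C :=
  (/ 2 * (dC_u f p + Ci * dC_v f p))%C.

Fixpoint Ck_on (k : nat) (Sigma : C -> Prop) (f : C -> R) : Prop :=
  (forall p : C, Sigma p -> continuous f p) /\
  match k with
  | O => True
  | S k' =>
      (forall p, Sigma p ->
         ex_derive (fun t => f (t, Im p)) (Re p) /\
         ex_derive (fun t => f (Re p, t)) (Im p)) /\
      Ck_on k' Sigma (d_u f) /\ Ck_on k' Sigma (d_v f)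
  end.

Definition smooth_on (Sigma : C -> Prop) (f : C -> R) : Prop :=
  forall k, Ck_on k Sigma f.

(** * Minkowski 4-space *)

Record vec4 (T : Type) : Type := Vec4 { c0 : T; c1 : T; c2 : T; c3 : T }.
Arguments Vec4 {T} _ _ _ _.
Arguments c0 {T} _.
Arguments c1 {T} _.
Arguments c2 {T} _.
Arguments c3 {T} _.

Definition L4 : Type := vec4 R.

Definition vadd (a b : L4) : L4 :=
  Vec4 (c0 a + c0 b) (c1 a + c1 b) (c2 a + c2 b) (c3 a + c3 b).
Definition vscale (r : R) (a : L4) : L4 :=
  Vec4 (r * c0 a) (r * c1 a) (r * c2 a) (r * c3 a).
Definition vzero : L4 := Vec4 0 0 0 0.

Definition lorentz (a b : L4) : R :=
  - (c0 a * c0 b) + c1 a * c1 b + c2 a * c2 b + c3 a * c3 b.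

(** Complex bilinear (not Hermitian) extension of [lorentz]. *)
Definition lorentzC (a b : vec4 C) : C :=
  (- (c0 a * c0 b) + c1 a * c1 b + c2 a * c2 b + c3 a * c3 b)%C.

Definition complexify (a : L4) : vec4 C :=
  Vec4 (RtoC (c0 a)) (RtoC (c1 a)) (RtoC (c2 a)) (RtoC (c3 a)).

Definition light_cone (a : L4) : Prop := lorentz a a = 0.
Definition vec_p : L4 := Vec4 1 0 0 1.
Definition I3 (a : L4) : Prop := lorentz a vec_p = 0.
Definition I3_point (l x y : R) : L4 := Vec4 l x y l.

Definition componentwise {A B : Type} (D : (C -> A) -> C -> B)
    (x : C -> vec4 A) (p : C) : vec4 B :=
  Vec4 (D (fun q => c0 (x q)) p) (D (fun q => c1 (x q)) p)
       (D (fun q => c2 (x q)) p) (D (fun q => c3 (x q)) p).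

Definition smooth_vec_on (Sigma : C -> Prop) (x : C -> L4) : Prop :=
  smooth_on Sigma (fun p => c0 (x p)) /\ smooth_on Sigma (fun p => c1 (x p)) /\
  smooth_on Sigma (fun p => c2 (x p)) /\ smooth_on Sigma (fun p => c3 (x p)).

(** * Conformal immersions into isotropic 3-space *)

(** The differential of [x] at [p] applied to the tangent vector
    [w = (du(w), dv(w))], the tangent plane of the z-plane being [C]. *)
Definition differential (x : C -> L4) (p w : C) : L4 :=
  vadd (vscale (Re w) (componentwise d_u x p))
       (vscale (Im w) (componentwise d_v x p)).

(** The induced metric [ds^2] as a quadratic form on tangent vectors. *)
Definition metric (x : C -> L4) (p w : C) : R :=
  lorentz (differential x p w) (differential x p w).

Definition conformal_immersion
    (Sigma : C -> Prop) (x : C -> L4) (sigma : C -> R) : Prop :=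
  smooth_vec_on Sigma x /\ smooth_on Sigma sigma /\
  (forall p, Sigma p -> I3 (x p)) /\
  (forall p w, Sigma p -> differential x p w = vzero -> w = RtoC 0) /\
  (forall p w, Sigma p ->
     metric x p w = exp (2 * sigma p) * ((Re w) ^ 2 + (Im w) ^ 2)).

Definition lightlike_gauss_map
    (Sigma : C -> Prop) (x g : C -> L4) : Prop :=
  smooth_vec_on Sigma g /\
  forall p, Sigma p ->
    light_cone (g p) /\ lorentz (g p) vec_p = 1 /\
    forall w, lorentz (differential x p w) (g p) = 0.

Definition x_zzbar (x : C -> L4) : C -> vec4 C :=
  componentwise d_zbar (componentwise d_z (fun p => complexify (x p))).
Definition x_zz (x : C -> L4) : C -> vec4 C :=
  componentwise d_z (componentwise d_z (fun p => complexify (x p))).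

(** Complex-valued because [x_zzbar] is; its value is always real. *)
Definition mean_curvature
    (x : C -> L4) (sigma : C -> R) (g : C -> L4) (p : C) : C :=
  (RtoC (2 * exp (- 2 * sigma p)) *
     lorentzC (x_zzbar x p) (complexify (g p)))%C.

(** A quadratic differential [q dz^2] is represented by [q]. *)
Definition hopf_differential (x g : C -> L4) (p : C) : C :=
  lorentzC (x_zz x p) (complexify (g p)).

(** * Adapted frames *)

Definition mat2 : Type := @matrix C 2 2.
Definition mk2 (a b c d : C) : mat2 :=
  mk_matrix 2 2 (fun i j =>
    match i, j with
    | O, O => a | O, _ => b | _, O => c | _, _ => d
    end).
Definition entry (M : mat2) (i j : nat) : C := coeff_mat (RtoC 0) M i j.
Definition mul2 (M N : mat2) : mat2 := @Mmult C_Ring 2 2 2 M N.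
Definition adjoint (M : mat2) : mat2 :=
  mk_matrix 2 2 (fun i j => Cconj (entry M j i)).
Definition scale2 (r : R) (M : mat2) : mat2 :=
  mk_matrix 2 2 (fun i j => (RtoC r * entry M i j)%C).
Definition entrywise (D : (C -> C) -> C -> C) (M : C -> mat2) (p : C) : mat2 :=
  mk_matrix 2 2 (fun i j => D (fun q => entry (M q) i j) p).

Definition hermitian_form (a : L4) : mat2 :=
  mk2 (c0 a + c3 a, 0) (c1 a, c2 a) (c1 a, - c2 a) (c0 a - c3 a, 0).

Definition E1 : mat2 := mk2 (RtoC 0) (RtoC 1) (RtoC 1) (RtoC 0).
Definition E2 : mat2 := mk2 (RtoC 0) Ci (- Ci)%C (RtoC 0).

Definition SU101 (M : mat2) : Prop :=
  exists (theta : R) (w : C),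
    M = mk2 (cos theta, sin theta) w (RtoC 0) (cos (- theta), sin (- theta)).

Definition smooth_mat_on (Sigma : C -> Prop) (F : C -> mat2) : Prop :=
  forall i j, (i < 2)%nat -> (j < 2)%nat ->
    smooth_on Sigma (fun p => Re (entry (F p) i j)) /\
    smooth_on Sigma (fun p => Im (entry (F p) i j)).

Definition adapted_frame (Sigma : C -> Prop) (x : C -> L4) (sigma : C -> R)
    (F : C -> mat2) : Prop :=
  smooth_mat_on Sigma F /\
  forall p, Sigma p ->
    SU101 (F p) /\
    entrywise dC_u (fun q => hermitian_form (x q)) p =
      scale2 (exp (sigma p)) (mul2 (mul2 (F p) E1) (adjoint (F p))) /\
    entrywise dC_v (fun q => hermitian_form (x q)) p =
      scale2 (exp (sigma p)) (mul2 (mul2 (F p) E2) (adjoint (F p))).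

(** * Holomorphic and meromorphic data *)

Definition holomorphic_on (Sigma : C -> Prop) (f : C -> C) : Prop :=
  forall p, Sigma p -> @ex_derive C_AbsRing C_NormedModule f p.

Definition holomorphic_at (f : C -> C) (p : C) : Prop :=
  exists U : C -> Prop, open U /\ U p /\ holomorphic_on U f.

Definition pole_at (f : C -> C) (p : C) : Prop :=
  exists (n : nat) (k : C -> C),
    (0 < n)%nat /\ holomorphic_at k p /\ k p <> RtoC 0 /\
    locally' p (fun z : C => f z = (k z / (z - p) ^ n)%C).

(** The value of the total function [f] at a pole carries no meaning. *)
Definition meromorphic_on (Sigma : C -> Prop) (f : C -> C) : Prop :=
  forall p, Sigma p -> holomorphic_at f p \/ pole_at f p.

(** A 1-form [phi dz] is represented by [phi].  The product [h^2 phi] is a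
    priori meaningless at the poles of [h], so its holomorphy says that it
    extends holomorphically over them. *)
Definition square_times_holomorphic (Sigma : C -> Prop) (h phi : C -> C) : Prop :=
  exists psi : C -> C, holomorphic_on Sigma psi /\
    forall p, Sigma p -> holomorphic_at h p -> psi p = (h p ^ 2 * phi p)%C.

(** [gamma'] is the velocity of the C^1 path [gamma : [0,1] -> Sigma]. *)
Definition C1_path_in (Sigma : C -> Prop) (gamma gamma' : R -> C) : Prop :=
  forall t, 0 <= t <= 1 ->
    Sigma (gamma t) /\
    @is_derive R_AbsRing C_R_NormedModule gamma t (gamma' t) /\
    continuous gamma' t.

(** [I] is the integral along [gamma] of the 1-form [f dz]. *)
Definition is_line_integral
    (f : C -> C) (gamma gamma' : R -> C) (I : C) : Prop :=
  @is_RInt C_R_NormedModule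
    (fun t => (f (gamma t) * gamma' t)%C) 0 1 I.

(** [x = Re \int (h, 1, -i) phi dz] up to a constant of integration, in the
    coordinates (l, x, y) of isotropic 3-space. *)
Definition weierstrass_representation
    (Sigma : C -> Prop) (x : C -> L4) (h phi : C -> C) : Prop :=
  forall gamma gamma' : R -> C, C1_path_in Sigma gamma gamma' ->
    exists Il Ix Iy : C,
      is_line_integral (fun z => h z * phi z)%C gamma gamma' Il /\
      is_line_integral (fun z => 1 * phi z)%C gamma gamma' Ix /\
      is_line_integral (fun z => - Ci * phi z)%C gamma gamma' Iy /\
      x (gamma 1) =
        vadd (x (gamma 0)) (I3_point (Re Il) (Re Ix) (Re Iy)).

(* Main.v *)
Require Import Defs.
From Stdlib Require Import Reals Lra.
From Coquelicot Require Import Coquelicot.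
Open Scope R_scope.

(** Write [x = (l, X, Y, l)].  Reading the upper right entry of the two frame
    equations, [F] being upper triangular, gives
    [X_v + i Y_v = i (X_u + i Y_u)]: the projection [X + i Y] of the surface
    to the plane is holomorphic
    ([adapted_frame_cauchy_riemann]).  In particular [X] and [Y] are harmonic,
    and [x_{z zbar}] has the single component [l_{z zbar}] along the null
    vector [p]; since [<g, p> = 1], minimality says exactly that [l] is
    harmonic too.

    For a harmonic function [f] the form [2 f_z dz], whose real part is [df],
    is holomorphic ([harmonic_gradient_form]); its coefficient is called
    [gradient_form f] here.  The Weierstrass data are
    [omega = 2 X_z dz] and [h = l_z / X_z].  By the Cauchy-Riemann equations
    [- i omega = 2 Y_z dz], and [h omega = 2 l_z dz] by construction, so the
    representation formula is the fundamental theorem of calculus along paths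
    ([line_integral_gradient_form]).  The conformal factor is
    [X_u ^ 2 + Y_u ^ 2 = |omega / dz| ^ 2], because the height [l] moves along
    the null direction; being positive, it shows that [omega] has no zeros, so
    that [h] is holomorphic on all of [Sigma] and poles never occur.

    The lightlike Gauss map is determined by linear equations: its two middle
    components by orthogonality to [x_u] and [x_v], the outer two by
    [<g, p> = 1] and [<g, g> = 0], which is linear in [g_0] once
    [g_3 = 1 + g_0] ([lightlike_normal_unique]).  For the Hopf
    differential, [4 <x_zz, g>] is, with a prime for the complex derivative and
    [phi = omega / dz],
    [2 (h phi)' - 2 phi' Re h - 2 i phi' Im h = 2 (h phi)' - 2 h phi' = 2 h' phi].
    *)

(** * Smooth real functions on an open set of the plane *)

Lemma smooth_continuous (Sigma : C -> Prop) (f : C -> R) :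
  smooth_on Sigma f -> forall p, Sigma p -> continuous f p.
Proof. intros Hf; exact (proj1 (Hf O)). Qed.

Lemma smooth_ex_derive (Sigma : C -> Prop) (f : C -> R) :
  smooth_on Sigma f -> forall p, Sigma p ->
  ex_derive (fun t => f (t, Im p)) (Re p) /\
  ex_derive (fun t => f (Re p, t)) (Im p).
Proof. intros Hf; exact (proj1 (proj2 (Hf 1%nat))). Qed.

Lemma smooth_d_u (Sigma : C -> Prop) (f : C -> R) :
  smooth_on Sigma f -> smooth_on Sigma (d_u f).
Proof. intros Hf k; exact (proj1 (proj2 (proj2 (Hf (S k))))). Qed.

Lemma smooth_d_v (Sigma : C -> Prop) (f : C -> R) :
  smooth_on Sigma f -> smooth_on Sigma (d_v f).
Proof. intros Hf k; exact (proj2 (proj2 (proj2 (Hf (S k))))). Qed.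

Lemma locally_horizontal (P : C -> Prop) (p : C) :
  locally p P -> locally (Re p) (fun t => P (t, Im p)).
Proof.
  intros [e He]; exists e; intros t Ht; apply He.
  split; [exact Ht | apply ball_center].
Qed.

Lemma locally_vertical (P : C -> Prop) (p : C) :
  locally p P -> locally (Im p) (fun t => P (Re p, t)).
Proof.
  intros [e He]; exists e; intros t Ht; apply He.
  split; [apply ball_center | exact Ht].
Qed.

Lemma d_u_ext_loc (f g : C -> R) (p : C) :
  locally p (fun q : C => f q = g q) -> d_u f p = d_u g p.
Proof. intros H; apply Derive_ext_loc, (locally_horizontal _ _ H). Qed.

Lemma d_v_ext_loc (f g : C -> R) (p : C) :
  locally p (fun q : C => f q = g q) -> d_v f p = d_v g p.
Proof. intros H; apply Derive_ext_loc, (locally_vertical _ _ H). Qed.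

Lemma d_u_opp (f : C -> R) (p : C) : d_u (fun q => - f q) p = - d_u f p.
Proof. exact (Derive_opp _ _). Qed.

Lemma d_v_opp (f : C -> R) (p : C) : d_v (fun q => - f q) p = - d_v f p.
Proof. exact (Derive_opp _ _). Qed.

Lemma d_u_scal (k : R) (f : C -> R) (p : C) :
  d_u (fun q => k * f q) p = k * d_u f p.
Proof. exact (Derive_scal _ _ _). Qed.

Lemma d_v_scal (k : R) (f : C -> R) (p : C) :
  d_v (fun q => k * f q) p = k * d_v f p.
Proof. exact (Derive_scal _ _ _). Qed.

(** Continuity of one of the two partial derivatives already upgrades their
    existence to total differentiability. *)
Lemma smooth_filterdiff (Sigma : C -> Prop) (f : C -> R) :
  open Sigma -> smooth_on Sigma f -> forall p, Sigma p ->
  @filterdiff R_AbsRing C_R_NormedModule R_NormedModule f (locally p)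
    (fun w => Re w * d_u f p + Im w * d_v f p).
Proof.
  intros Ho Hf p Hp.
  assert (H : filterdiff (fun w : R * R => (fun a b => f (a, b)) (fst w) (snd w))
    (locally (Re p, Im p))
    (fun w : R * R => plus (scal (fst w) ((fun a b => d_u f (a, b)) (Re p) (Im p)))
       (scal (snd w) (d_v f p)))).
  { apply (is_derive_filterdiff (fun a b => f (a, b)) (Re p) (Im p)
      (fun a b => d_u f (a, b)) (d_v f p)).
    - generalize (Ho p Hp); destruct p as [a b]; apply filter_imp.
      intros q Hq; apply Derive_correct.
      exact (proj1 (smooth_ex_derive _ _ Hf q Hq)).
    - apply Derive_correct; exact (proj2 (smooth_ex_derive _ _ Hf p Hp)).
    - apply (continuous_ext (d_u f)); [intros [a b]; reflexivity|].
      destruct p as [a b].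
      exact (smooth_continuous _ _ (smooth_d_u _ _ Hf) _ Hp). }
  destruct p as [a b].
  refine (filterdiff_ext _ _ _ _ H).
  intros [u v]; reflexivity.
Qed.

Lemma smooth_mixed_partials (Sigma : C -> Prop) (f : C -> R) :
  open Sigma -> smooth_on Sigma f -> forall p, Sigma p ->
  d_u (d_v f) p = d_v (d_u f) p.
Proof.
  intros Ho Hf [a b] Hp.
  apply (Schwarz (fun u v => f (u, v)) a b).
  - apply locally_2d_locally.
    generalize (Ho _ Hp); apply filter_imp; intros [u v] Hq; simpl.
    destruct (smooth_ex_derive _ _ Hf _ Hq) as [H1 H2].
    destruct (smooth_ex_derive _ _ (smooth_d_u _ _ Hf) _ Hq) as [H3 H4].
    destruct (smooth_ex_derive _ _ (smooth_d_v _ _ Hf) _ Hq) as [H5 H6].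
    repeat split; assumption.
  - apply continuity_2d_pt_filterlim.
    apply (continuous_ext (d_u (d_v f))); [intros [u v]; reflexivity|].
    exact (smooth_continuous _ _ (smooth_d_u _ _ (smooth_d_v _ _ Hf)) _ Hp).
  - apply continuity_2d_pt_filterlim.
    apply (continuous_ext (d_v (d_u f))); [intros [u v]; reflexivity|].
    exact (smooth_continuous _ _ (smooth_d_v _ _ (smooth_d_u _ _ Hf)) _ Hp).
Qed.

(** * Complex differentiability *)

(** The epsilon form of complex differentiability.  It is the common ground on
    which complex derivatives are compared with real ones, the two being
    phrased over different scalar fields. *)
Lemma is_derive_C_iff (f : C -> C) (p c : C) :
  @is_derive C_AbsRing C_NormedModule f p c <->
  forall eps : posreal, @locally C_UniformSpace p
    (fun q => Cmod (f q - f p - (q - p) * c)%C <= eps * Cmod (q - p)%C).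
Proof.
  split.
  - intros [_ H] eps.
    apply locally_C; apply (H p (fun P HP => HP) eps).
  - intros H; split; [apply is_linear_scal_l|].
    intros q Hq eps.
    rewrite <- (is_filter_lim_locally_unique _ _ Hq).
    apply locally_C, H.
Qed.

(** The two normed module structures that [C] carries over itself have the same
    norm but uniform structures given by different data.  The general Leibniz
    rule concerns the one that every absolute ring has, [holomorphic_on] the one
    inherited from the plane. *)
Lemma is_derive_regular_module (f : C -> C) (p c : C) :
  @is_derive C_AbsRing (AbsRing_NormedModule C_AbsRing) f p c <->
  @is_derive C_AbsRing C_NormedModule f p c.
Proof.
  split; intros [_ H]; (split; [apply is_linear_scal_l | exact H]).
Qed.

Lemma is_derive_Cmult (f g : C -> C) (p a b : C) :
  @is_derive C_AbsRing C_NormedModule f p a ->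
  @is_derive C_AbsRing C_NormedModule g p b ->
  @is_derive C_AbsRing C_NormedModule
    (fun q => f q * g q)%C p (a * g p + f p * b)%C.
Proof.
  rewrite <- !is_derive_regular_module; intros Hf Hg.
  exact (@is_derive_mult C_AbsRing f g p a b Hf Hg Cmult_comm).
Qed.

(** The error of the linear approximation at [p] is exactly
    [(q - p) ^ 2 / (q p ^ 2)], quadratic in [q - p] while [q] stays away
    from [0]. *)
Lemma is_derive_Cinv (p : C) :
  p <> RtoC 0 ->
  @is_derive C_AbsRing C_NormedModule Cinv p (- / (p * p))%C.
Proof.
  intros Hp; apply is_derive_C_iff; intros eps.
  pose proof (Cmod_gt_0 p) as [Hm _]; specialize (Hm Hp).
  pose proof (cond_pos eps) as He.
  set (m := Cmod p) in *.
  (* Within [m / 2] of [p], [|q| > m / 2] and the error is at most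
     [2 |q - p| ^ 2 / m ^ 3]. *)
  set (d := Rmin (m / 2) (eps * (m * m * m) / 2)).
  assert (Hd : 0 < d).
  { apply Rmin_pos; [lra|].
    assert (0 < eps * (m * m * m)) by (repeat apply Rmult_lt_0_compat; assumption).
    lra. }
  apply locally_C; exists (mkposreal d Hd); intros q Hq.
  change (Cmod (q - p)%C < d) in Hq.
  assert (H1 : Cmod (q - p)%C < m / 2)
    by (apply Rlt_le_trans with (1 := Hq), Rmin_l).
  assert (H2 : Cmod (q - p)%C < eps * (m * m * m) / 2)
    by (apply Rlt_le_trans with (1 := Hq), Rmin_r).
  assert (Hq2 : m / 2 < Cmod q).
  { assert (m <= Cmod q + Cmod (q - p)%C).
    { replace (Cmod (q - p)%C) with (Cmod (p - q)%C)
        by (rewrite <- Cmod_opp; f_equal; ring).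
      unfold m; replace p with (q + (p - q))%C at 1 by ring.
      apply Cmod_triangle. }
    lra. }
  assert (Hq0 : q <> RtoC 0) by (apply Cmod_gt_0; lra).
  replace (/ q - / p - (q - p) * - / (p * p))%C
    with (((q - p) * (q - p)) * / (q * (p * p)))%C
    by (field; split; assumption).
  rewrite Cmod_mult, Cmod_inv, !Cmod_mult.
  2: { repeat apply Cmult_neq_0; assumption. }
  fold m.
  pose proof (Cmod_ge_0 (q - p)%C) as Hn.
  set (n := Cmod (q - p)%C) in *; set (k := Cmod q) in *.
  assert (Hk : 0 < k * (m * m)) by (repeat apply Rmult_lt_0_compat; lra).
  apply (Rmult_le_reg_r (k * (m * m)) _ _ Hk).
  rewrite Rmult_assoc, Rinv_l, Rmult_1_r by lra.
  replace (eps * n * (k * (m * m))) with (n * (eps * (m * m) * k)) by ring.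
  apply Rmult_le_compat_l; [exact Hn|].
  apply Rle_trans with (eps * (m * m) * (m / 2)); [lra|].
  apply Rmult_le_compat_l; [|lra].
  repeat apply Rmult_le_pos; lra.
Qed.

Lemma is_derive_Cdiv (f g : C -> C) (p a b : C) :
  g p <> RtoC 0 ->
  @is_derive C_AbsRing C_NormedModule f p a ->
  @is_derive C_AbsRing C_NormedModule g p b ->
  @is_derive C_AbsRing C_NormedModule (fun q => f q / g q)%C p
    ((a * g p - f p * b) / (g p * g p))%C.
Proof.
  intros Hg Df Dg.
  replace ((a * g p - f p * b) / (g p * g p))%C
    with (a * / g p + f p * (b * - / (g p * g p)))%C
    by (field; assumption).
  apply (is_derive_Cmult f (fun q => / g q)%C); [exact Df|].
  exact (@is_derive_comp C_AbsRing C_NormedModule Cinv g p _ _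
    (is_derive_Cinv _ Hg) (proj2 (is_derive_regular_module _ _ _) Dg)).
Qed.

Lemma Cmod_Ci : Cmod Ci = 1.
Proof.
  transitivity (sqrt 1); [unfold Cmod; apply f_equal; simpl; ring | apply sqrt_1].
Qed.

(** A complex derivative restricts to every real line through the point; the
    horizontal and vertical lines give the partial derivatives. *)
Lemma is_derive_along_line (f : C -> C) (p c e : C) (k : R -> C) (t0 : R) :
  @is_derive C_AbsRing C_NormedModule f p c ->
  Cmod e = 1 -> (forall t, k t = p + RtoC (t - t0) * e)%C ->
  is_derive (fun t => Re (f (k t))) t0 (Re (e * c)%C) /\
  is_derive (fun t => Im (f (k t))) t0 (Im (e * c)%C).
Proof.
  intros Hf He Hk.
  assert (Hk0 : k t0 = p).
  { rewrite Hk; replace (t0 - t0) with 0 by ring; ring. }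
  assert (Hn : forall t, Cmod (k t - p)%C = Rabs (t - t0)).
  { intros t; rewrite Hk.
    replace (p + RtoC (t - t0) * e - p)%C with (RtoC (t - t0) * e)%C by ring.
    rewrite Cmod_mult, He, Cmod_R; ring. }
  assert (H : forall eps : posreal, locally t0 (fun t =>
    Cmod (f (k t) - f p - RtoC (t - t0) * (e * c))%C <= eps * Rabs (t - t0))).
  { intros eps.
    pose proof (proj1 (is_derive_C_iff f p c) Hf eps) as L.
    apply locally_C in L; destruct L as [d Hd].
    exists d; intros t Ht.
    rewrite <- Hn.
    replace (RtoC (t - t0) * (e * c))%C with ((k t - p) * c)%C
      by (rewrite Hk; ring).
    apply Hd; change (Cmod (k t - p)%C < d); rewrite Hn; exact Ht. }
  split; (split; [apply is_linear_scal_l|]); intros s Hs eps;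
    rewrite <- (is_filter_lim_locally_unique _ _ Hs), Hk0;
    generalize (H eps); apply filter_imp; intros t;
    apply Rle_trans.
  - apply Rle_trans with (2 := re_le_Cmod _); apply Req_le, f_equal.
    unfold minus, plus, opp, scal, Re, Im; simpl; unfold mult; simpl; ring.
  - apply Rle_trans with (2 := Rmax_Cmod _), Rle_trans with (2 := Rmax_r _ _).
    apply Req_le, f_equal.
    unfold minus, plus, opp, scal, Re, Im; simpl; unfold mult; simpl; ring.
Qed.

Lemma is_derive_d_z (f : C -> C) (p c : C) :
  @is_derive C_AbsRing C_NormedModule f p c -> d_z f p = c.
Proof.
  intros Hf.
  destruct (is_derive_along_line f p c (RtoC 1) (fun t => (t, Im p)) (Re p) Hf)
    as [H1 H2].
  { rewrite Cmod_R; apply Rabs_R1. }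
  { intros t; apply injective_projections; unfold Re, Im; simpl; ring. }
  destruct (is_derive_along_line f p c Ci (fun t => (Re p, t)) (Im p) Hf)
    as [H3 H4].
  { exact Cmod_Ci. }
  { intros t; apply injective_projections; unfold Re, Im; simpl; ring. }
  apply is_derive_unique in H1, H2, H3, H4.
  change (d_u (fun q => Re (f q)) p = Re (RtoC 1 * c)%C) in H1.
  change (d_u (fun q => Im (f q)) p = Im (RtoC 1 * c)%C) in H2.
  change (d_v (fun q => Re (f q)) p = Re (Ci * c)%C) in H3.
  change (d_v (fun q => Im (f q)) p = Im (Ci * c)%C) in H4.
  unfold d_z, dC_u, dC_v; rewrite H1, H2, H3, H4.
  apply injective_projections; unfold Re, Im; simpl; field.
Qed.

Lemma d_z_ext_loc (f g : C -> C) (p : C) :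
  locally p (fun q : C => f q = g q) -> d_z f p = d_z g p.
Proof.
  intros H.
  assert (HR : locally p (fun q : C => Re (f q) = Re (g q)))
    by (revert H; apply filter_imp; intros q ->; reflexivity).
  assert (HI : locally p (fun q : C => Im (f q) = Im (g q)))
    by (revert H; apply filter_imp; intros q ->; reflexivity).
  unfold d_z, dC_u, dC_v.
  rewrite (d_u_ext_loc _ _ _ HR), (d_u_ext_loc _ _ _ HI),
    (d_v_ext_loc _ _ _ HR), (d_v_ext_loc _ _ _ HI).
  reflexivity.
Qed.


(** * Harmonic functions and their gradient forms *)

(** The coefficient of the 1-form [2 f_z dz], the only form [phi dz] whose real
    part is [df]. *)
Definition gradient_form (f : C -> R) (p : C) : C := (d_u f p, - d_v f p).

Definition laplacian (f : C -> R) (p : C) : R := d_u (d_u f) p + d_v (d_v f) p.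

Lemma d_z_RtoC (f : C -> R) (p : C) :
  d_z (fun q => RtoC (f q)) p = (/ 2 * gradient_form f p)%C.
Proof.
  unfold d_z, dC_u, dC_v.
  replace (d_u (fun q => Im (RtoC (f q))) p) with 0
    by (symmetry; exact (Derive_const 0 _)).
  replace (d_v (fun q => Im (RtoC (f q))) p) with 0
    by (symmetry; exact (Derive_const 0 _)).
  change (d_u (fun q => Re (RtoC (f q))) p) with (d_u f p).
  change (d_v (fun q => Re (RtoC (f q))) p) with (d_v f p).
  apply injective_projections; simpl; field.
Qed.

Lemma d_zbar_d_z_RtoC (Sigma : C -> Prop) (f : C -> R) :
  open Sigma -> smooth_on Sigma f -> forall p, Sigma p ->
  d_zbar (fun q => d_z (fun r => RtoC (f r)) q) p = RtoC (/ 4 * laplacian f p).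
Proof.
  intros Ho Hf p Hp.
  assert (HR : forall q : C, Re (d_z (fun r => RtoC (f r)) q) = / 2 * d_u f q).
  { intros q; rewrite d_z_RtoC; unfold Re, Im; simpl; field. }
  assert (HI : forall q : C, Im (d_z (fun r => RtoC (f r)) q) = (- / 2) * d_v f q).
  { intros q; rewrite d_z_RtoC; unfold Re, Im; simpl; field. }
  unfold d_zbar, dC_u, dC_v.
  rewrite (d_u_ext_loc _ _ p (filter_forall _ HR)),
    (d_u_ext_loc _ _ p (filter_forall _ HI)),
    (d_v_ext_loc _ _ p (filter_forall _ HR)),
    (d_v_ext_loc _ _ p (filter_forall _ HI)).
  rewrite !d_u_scal, !d_v_scal, (smooth_mixed_partials _ _ Ho Hf p Hp).
  apply injective_projections; unfold laplacian, Re, Im; simpl; field.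
Qed.

(** The Cauchy-Riemann equations of [f_u - i f_v] are [laplacian f = 0] and the
    symmetry of the second derivatives.  They turn the real differentials of
    [f_u] and [f_v] at [p] into the real and imaginary parts of one complex
    multiplication. *)
Lemma harmonic_gradient_form (Sigma : C -> Prop) (f : C -> R) :
  open Sigma -> smooth_on Sigma f -> forall p, Sigma p -> laplacian f p = 0 ->
  @is_derive C_AbsRing C_NormedModule (gradient_form f) p
    (gradient_form (d_u f) p).
Proof.
  intros Ho Hf p Hp Hlap.
  destruct (smooth_filterdiff _ _ Ho (smooth_d_u _ _ Hf) p Hp) as [_ DR].
  destruct (smooth_filterdiff _ _ Ho (smooth_d_v _ _ Hf) p Hp) as [_ DI].
  specialize (DR p (fun P HP => HP)); specialize (DI p (fun P HP => HP)).
  rewrite (smooth_mixed_partials _ _ Ho Hf p Hp) in DI.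
  replace (d_v (d_v f) p) with (- d_u (d_u f) p) in DI
    by (unfold laplacian in Hlap; lra).
  apply is_derive_C_iff; intros eps.
  assert (He : 0 < eps / 2) by (pose proof (cond_pos eps); lra).
  generalize (filter_and _ _ (DR (mkposreal _ He)) (DI (mkposreal _ He))).
  apply filter_imp; intros q [H1 H2].
  set (E := (gradient_form f q - gradient_form f p
             - (q - p) * gradient_form (d_u f) p)%C).
  assert (HE : Cmod E <= Rabs (Re E) + Rabs (Im E)).
  { replace E with (RtoC (Re E) + RtoC (Im E) * Ci)%C at 1
      by (apply injective_projections; unfold Re, Im; simpl; ring).
    apply Rle_trans with (1 := Cmod_triangle _ _).
    rewrite Cmod_mult, !Cmod_R, Cmod_Ci; lra. }
  assert (Hn : norm (minus (q : C_R_NormedModule) p) = Cmod (q - p)%C).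
  { unfold Cmod; simpl; unfold norm; simpl; unfold prod_norm; simpl.
    f_equal; unfold norm; simpl; unfold abs; simpl.
    rewrite !Rmult_1_r, <- !Rabs_mult, !Rabs_pos_eq by apply Rle_0_sqr.
    reflexivity. }
  assert (K1 : Rabs (Re E) <= eps / 2 * Cmod (q - p)%C).
  { rewrite <- Hn; apply Rle_trans with (2 := H1); apply Req_le.
    unfold norm; simpl; unfold abs; simpl; f_equal.
    unfold E, gradient_form, minus, plus, opp, Re, Im; simpl; ring. }
  assert (K2 : Rabs (Im E) <= eps / 2 * Cmod (q - p)%C).
  { rewrite <- Hn; apply Rle_trans with (2 := H2); apply Req_le.
    unfold norm; simpl; unfold abs; simpl; rewrite <- Rabs_Ropp; f_equal.
    unfold E, gradient_form, minus, plus, opp, Re, Im; simpl; ring. }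
  lra.
Qed.

Lemma is_derive_along_path (Sigma : C -> Prop) (f : C -> R)
    (gamma : R -> C) (t : R) (w : C) :
  open Sigma -> smooth_on Sigma f -> Sigma (gamma t) ->
  @is_derive R_AbsRing C_R_NormedModule gamma t w ->
  is_derive (fun s => f (gamma s)) t (Re (gradient_form f (gamma t) * w)%C).
Proof.
  intros Ho Hf Ht Hg.
  refine (filterdiff_ext_lin _ _ _ (@filterdiff_comp' R_AbsRing
    (AbsRing_NormedModule R_AbsRing) C_R_NormedModule R_NormedModule
    gamma f t _ _ Hg (smooth_filterdiff _ _ Ho Hf _ Ht)) _).
  intros y; unfold scal, gradient_form, Re, Im; simpl; unfold mult; simpl.
  unfold scal; simpl; unfold mult; simpl; ring.
Qed.

(** Only the real part of the integrand along the path is a derivative, of [f]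
    composed with the path; the imaginary part is integrable by continuity. *)
Lemma line_integral_gradient_form (Sigma : C -> Prop) (f : C -> R)
    (omega : C -> C) (gamma gamma' : R -> C) :
  open Sigma -> smooth_on Sigma f ->
  (forall p, Sigma p -> omega p = gradient_form f p) ->
  C1_path_in Sigma gamma gamma' ->
  exists I : C, is_line_integral omega gamma gamma' I /\
    Re I = f (gamma 1) - f (gamma 0).
Proof.
  intros Ho Hf Homega Hgamma.
  set (W := fun t => (gradient_form f (gamma t) * gamma' t)%C).
  assert (Hu : forall g, smooth_on Sigma g ->
            forall t, 0 <= t <= 1 -> continuous (fun s => g (gamma s)) t).
  { intros g Hg t Ht; destruct (Hgamma t Ht) as (H1 & H2 & _).
    apply (continuous_comp gamma g).
    - exact (@ex_derive_continuous R_AbsRing C_R_NormedModule gamma t (ex_intro _ _ H2)).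
    - exact (smooth_continuous _ _ Hg _ H1). }
  assert (Hfst : forall t, 0 <= t <= 1 -> continuous (fun s => fst (gamma' s)) t).
  { intros t Ht; destruct (Hgamma t Ht) as (_ & _ & H3).
    apply (continuous_comp gamma' fst _ H3), continuous_fst. }
  assert (Hsnd : forall t, 0 <= t <= 1 -> continuous (fun s => snd (gamma' s)) t).
  { intros t Ht; destruct (Hgamma t Ht) as (_ & _ & H3).
    apply (continuous_comp gamma' snd _ H3), continuous_snd. }
  pose proof (Hu _ (smooth_d_u _ _ Hf)) as Cu.
  pose proof (Hu _ (smooth_d_v _ _ Hf)) as Cv.
  assert (CR : forall t, 0 <= t <= 1 -> continuous (fun s => fst (W s)) t).
  { intros t Ht.
    apply (continuous_minus (V := R_NormedModule)
      (fun s => d_u f (gamma s) * fst (gamma' s))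
      (fun s => - d_v f (gamma s) * snd (gamma' s))).
    - apply (continuous_mult (K := R_AbsRing)); auto.
    - apply (continuous_mult (K := R_AbsRing)); auto.
      apply (continuous_opp (V := R_NormedModule)); auto. }
  assert (CI : forall t, 0 <= t <= 1 -> continuous (fun s => snd (W s)) t).
  { intros t Ht.
    apply (continuous_plus (V := R_NormedModule)
      (fun s => d_u f (gamma s) * snd (gamma' s))
      (fun s => - d_v f (gamma s) * fst (gamma' s))).
    - apply (continuous_mult (K := R_AbsRing)); auto.
    - apply (continuous_mult (K := R_AbsRing)); auto.
      apply (continuous_opp (V := R_NormedModule)); auto. }
  assert (Hmin : Rmin 0 1 = 0) by (apply Rmin_left; lra).
  assert (Hmax : Rmax 0 1 = 1) by (apply Rmax_right; lra).
  assert (RR : is_RInt (fun t => fst (W t)) 0 1 (f (gamma 1) - f (gamma 0))).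
  { apply (is_RInt_derive (V := R_CompleteNormedModule) (fun t => f (gamma t)));
      rewrite Hmin, Hmax; [|exact CR].
    intros t Ht; destruct (Hgamma t Ht) as (H1 & H2 & _).
    exact (is_derive_along_path _ _ _ _ _ Ho Hf H1 H2). }
  destruct (ex_RInt_continuous (V := R_CompleteNormedModule)
    (fun t => snd (W t)) 0 1) as [J RI].
  { rewrite Hmin, Hmax; exact CI. }
  exists (f (gamma 1) - f (gamma 0), J); split; [|reflexivity].
  apply (is_RInt_ext W).
  - rewrite Hmin, Hmax; intros t Ht; unfold W.
    rewrite Homega; [reflexivity|].
    destruct (Hgamma t) as [H _]; [lra | exact H].
  - exact (@is_RInt_fct_extend_pair R_NormedModule R_NormedModule W 0 1 _ _ RR RI).
Qed.

(** Both Laplacians reduce to a difference of mixed partial derivatives. *)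
Lemma cauchy_riemann_laplacian (Sigma : C -> Prop) (f g : C -> R) :
  open Sigma -> smooth_on Sigma f -> smooth_on Sigma g ->
  (forall p, Sigma p -> d_v f p = - d_u g p /\ d_v g p = d_u f p) ->
  forall p, Sigma p -> laplacian f p = 0 /\ laplacian g p = 0.
Proof.
  intros Ho Hf Hg CR p Hp; unfold laplacian.
  assert (Hfu : d_u (d_u f) p = d_u (d_v g) p).
  { apply d_u_ext_loc; generalize (Ho p Hp); apply filter_imp.
    intros q Hq; symmetry; apply CR, Hq. }
  assert (Hfv : d_v (d_v f) p = - d_v (d_u g) p).
  { rewrite <- d_v_opp.
    apply d_v_ext_loc; generalize (Ho p Hp); apply filter_imp.
    intros q Hq; apply CR, Hq. }
  assert (Hgu : d_u (d_u g) p = - d_u (d_v f) p).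
  { rewrite <- d_u_opp.
    apply d_u_ext_loc; generalize (Ho p Hp); apply filter_imp.
    intros q Hq; destruct (CR q Hq); lra. }
  assert (Hgv : d_v (d_v g) p = d_v (d_u f) p).
  { apply d_v_ext_loc; generalize (Ho p Hp); apply filter_imp.
    intros q Hq; apply CR, Hq. }
  rewrite Hfu, Hfv, Hgu, Hgv.
  rewrite (smooth_mixed_partials _ _ Ho Hf p Hp),
    (smooth_mixed_partials _ _ Ho Hg p Hp).
  lra.
Qed.

Lemma partials_ext_on (Sigma : C -> Prop) (f g : C -> R) :
  open Sigma -> (forall q, Sigma q -> f q = g q) ->
  forall p, Sigma p ->
  d_u f p = d_u g p /\ d_v f p = d_v g p /\ laplacian f p = laplacian g p.
Proof.
  intros Ho H.
  assert (Hu : forall p, Sigma p -> d_u f p = d_u g p).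
  { intros p Hp; apply d_u_ext_loc.
    generalize (Ho p Hp); apply filter_imp; exact H. }
  assert (Hv : forall p, Sigma p -> d_v f p = d_v g p).
  { intros p Hp; apply d_v_ext_loc.
    generalize (Ho p Hp); apply filter_imp; exact H. }
  intros p Hp; repeat split; auto.
  unfold laplacian; f_equal; [apply d_u_ext_loc | apply d_v_ext_loc];
    generalize (Ho p Hp); apply filter_imp; assumption.
Qed.

(** * Surfaces in isotropic 3-space *)

Lemma frame_upper_right (a w b k k' : C) :
  entry (mul2 (mul2 (mk2 a w (RtoC 0) b) (mk2 (RtoC 0) k k' (RtoC 0)))
           (adjoint (mk2 a w (RtoC 0) b))) 0 1
  = (k * (a * Cconj b))%C.
Proof.
  unfold entry, mul2, Mmult, adjoint, mk2, entry.
  rewrite !coeff_mat_bij by auto; simpl pred.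
  rewrite !sum_Sn, !sum_O, !coeff_mat_bij by auto.
  rewrite !sum_Sn, !sum_O, !coeff_mat_bij by auto.
  apply injective_projections; simpl; ring.
Qed.

(** The upper right entries of the frame equations express [X_u + i Y_u] and
    [X_v + i Y_v] by the diagonal of the frame alone, with a ratio [i] between
    the two. *)
Lemma adapted_frame_cauchy_riemann (Sigma : C -> Prop) (x : C -> L4)
    (sigma : C -> R) (F : C -> mat2) :
  adapted_frame Sigma x sigma F -> forall p, Sigma p ->
  d_v (fun q => Defs.c1 (x q)) p = - d_u (fun q => Defs.c2 (x q)) p /\
  d_v (fun q => Defs.c2 (x q)) p = d_u (fun q => Defs.c1 (x q)) p.
Proof.
  intros [_ H] p Hp; destruct (H p Hp) as ((theta & w & HF) & Hu & Hv).
  rewrite HF in Hu, Hv.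
  apply (f_equal (fun M => entry M 0 1)) in Hu, Hv.
  unfold scale2 in Hu, Hv.
  unfold entry in Hu at 1 2; unfold entry in Hv at 1 2.
  unfold entrywise in Hu, Hv.
  rewrite !coeff_mat_bij in Hu, Hv by auto.
  unfold Defs.E1 in Hu; unfold Defs.E2 in Hv.
  rewrite frame_upper_right in Hu, Hv.
  set (a := (_ * Cconj _)%C) in Hu, Hv.
  change (dC_u (fun q => (Defs.c1 (x q), Defs.c2 (x q))) p = (RtoC (exp (sigma p)) * (RtoC 1 * a))%C)
    in Hu.
  change (dC_v (fun q => (Defs.c1 (x q), Defs.c2 (x q))) p
    = (RtoC (exp (sigma p)) * (Ci * a))%C) in Hv.
  assert (Huv : dC_v (fun q => (Defs.c1 (x q), Defs.c2 (x q))) p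
              = (Ci * dC_u (fun q => (Defs.c1 (x q), Defs.c2 (x q))) p)%C)
    by (rewrite Hu, Hv; ring).
  pose proof (f_equal fst Huv) as H1; pose proof (f_equal snd Huv) as H2.
  unfold Re, Im in H1, H2; simpl in H1, H2.
  lra.
Qed.

Lemma I3_last (a : L4) : I3 a -> Defs.c3 a = Defs.c0 a.
Proof. unfold I3, lorentz, vec_p; simpl; lra. Qed.

(** Here [(lu, a, b, lu)] and [(lv, - b, a, lv)] are the tangent vectors [x_u] and
    [x_v] of a surface whose projection to the plane is holomorphic with
    derivative [a + i b]. *)
Lemma lightlike_normal_unique (n : L4) (lu lv a b : R) (h : C) :
  light_cone n -> lorentz n vec_p = 1 ->
  lorentz (Vec4 lu a b lu) n = 0 -> lorentz (Vec4 lv (- b) a lv) n = 0 ->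
  0 < a ^ 2 + b ^ 2 -> (h * (a, b))%C = (lu, - lv) ->
  n = vscale (- / 2)
        (Vec4 (1 + Cmod h ^ 2) (2 * Re h) (- 2 * Im h) (- 1 + Cmod h ^ 2)).
Proof.
  intros Hn Hp Hu Hv Hpos Hh; rewrite Cmod2_alt.
  destruct n as [n0 n1 n2 n3]; destruct h as [h1 h2].
  pose proof (f_equal fst Hh) as Hh1; pose proof (f_equal snd Hh) as Hh2.
  unfold light_cone, lorentz, vec_p, vscale, Re, Im in *; simpl in *.
  assert (E3 : n3 = 1 + n0) by lra; subst n3.
  (* Orthogonality, rewritten with the value of [h], says that
     [(n1 + h1, n2 - h2)] is annihilated by the matrix [(a, b; - b, a)]. *)
  assert (Ku : (n1 + h1) * a + (n2 - h2) * b = 0) by (ring_simplify in Hu; lra).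
  assert (Kv : (n2 - h2) * a - (n1 + h1) * b = 0) by (ring_simplify in Hv; lra).
  assert (K1 : (n1 + h1) * (a ^ 2 + b ^ 2) = 0).
  { replace ((n1 + h1) * (a ^ 2 + b ^ 2))
      with (a * ((n1 + h1) * a + (n2 - h2) * b)
            - b * ((n2 - h2) * a - (n1 + h1) * b)) by ring.
    rewrite Ku, Kv; ring. }
  assert (K2 : (n2 - h2) * (a ^ 2 + b ^ 2) = 0).
  { replace ((n2 - h2) * (a ^ 2 + b ^ 2))
      with (b * ((n1 + h1) * a + (n2 - h2) * b)
            + a * ((n2 - h2) * a - (n1 + h1) * b)) by ring.
    rewrite Ku, Kv; ring. }
  assert (E1 : n1 = - h1) by (apply Rmult_integral in K1; simpl in K1; lra).
  assert (E2 : n2 = h2) by (apply Rmult_integral in K2; simpl in K2; lra).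
  subst n1 n2; ring_simplify in Hn.
  f_equal; lra.
Qed.

Theorem theorem3p9 :
  forall (Sigma : C -> Prop) (x : C -> L4) (sigma : C -> R) (g : C -> L4),
    simply_connected_domain Sigma ->
    conformal_immersion Sigma x sigma ->
    lightlike_gauss_map Sigma x g ->
    (forall p, Sigma p -> mean_curvature x sigma g p = RtoC 0) ->
    (exists F : C -> mat2, adapted_frame Sigma x sigma F) ->
    exists h phi : C -> C,
      meromorphic_on Sigma h /\
      holomorphic_on Sigma phi /\
      square_times_holomorphic Sigma h phi /\
      weierstrass_representation Sigma x h phi /\
      (forall p w, Sigma p -> metric x p w = Cmod (phi p) ^ 2 * Cmod w ^ 2) /\
      (forall p, Sigma p ->
         hopf_differential x g p = (/ 2 * (phi p * d_z h p))%C) /\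
      (forall p, Sigma p ->
         g p = vscale (- / 2)
                 (Vec4 (1 + Cmod (h p) ^ 2) (2 * Re (h p))
                       (- 2 * Im (h p)) (- 1 + Cmod (h p) ^ 2))).
Proof.
  intros Sigma x sigma g (Ho & _) (Hx & _ & HI3 & _ & Hmetric) (_ & Hg) Hmean
    [F HF].
  destruct Hx as (Hl & HX & HY & Hl').
  pose proof (adapted_frame_cauchy_riemann _ _ _ _ HF) as CR; clear F HF.
  set (l := fun q => Defs.c0 (x q)) in *.
  set (X := fun q => Defs.c1 (x q)) in *.
  set (Y := fun q => Defs.c2 (x q)) in *.
  set (l' := fun q => Defs.c3 (x q)) in *.
  pose proof (partials_ext_on Sigma l' l Ho
    (fun q Hq => I3_last _ (HI3 q Hq))) as Hll.
  pose proof (cauchy_riemann_laplacian _ _ _ Ho HX HY CR) as HlapXY.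
  set (phi := gradient_form X).
  set (h := fun q => (gradient_form l q / phi q)%C).
  assert (Htu : forall p, Sigma p -> Defs.differential x p (RtoC 1)
    = Vec4 (d_u l p) (d_u X p) (d_u Y p) (d_u l p)).
  { intros p Hp; destruct (Hll p Hp) as [E _].
    rewrite <- E at 2; unfold l, X, Y, l', Defs.differential, vadd, vscale, Re, Im; simpl.
    f_equal; ring. }
  assert (Htv : forall p, Sigma p -> Defs.differential x p Ci
    = Vec4 (d_v l p) (- d_u Y p) (d_u X p) (d_v l p)).
  { intros p Hp; destruct (Hll p Hp) as (_ & E & _).
    destruct (CR p Hp) as [<- <-].
    rewrite <- E at 2; unfold l, X, Y, l', Defs.differential, vadd, vscale, Re, Im; simpl.
    f_equal; ring. }
  assert (HphiE : forall p, Sigma p -> phi p = (d_u X p, d_u Y p)).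
  { intros p Hp; unfold phi, gradient_form; destruct (CR p Hp) as [-> _].
    rewrite Ropp_involutive; reflexivity. }
  assert (Hphi2 : forall p, Sigma p -> Cmod (phi p) ^ 2 = exp (2 * sigma p)).
  { intros p Hp.
    pose proof (Hmetric p (RtoC 1) Hp) as H.
    unfold metric in H; rewrite Htu in H by exact Hp.
    rewrite Cmod2_alt, HphiE by exact Hp.
    unfold lorentz, Re, Im in *; simpl in *; lra. }
  assert (Hphi0 : forall p, Sigma p -> phi p <> RtoC 0).
  { intros p Hp E; pose proof (Hphi2 p Hp) as H; rewrite E, Cmod_0 in H.
    pose proof (exp_pos (2 * sigma p)); lra. }
  assert (Hhphi : forall p, Sigma p -> (h p * phi p)%C = gradient_form l p).
  { intros p Hp; unfold h; field; auto. }
  assert (HiY : forall p, Sigma p -> (- Ci * phi p)%C = gradient_form Y p).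
  { intros p Hp; destruct (CR p Hp) as [E3 E4].
    unfold phi, gradient_form; rewrite E3, E4.
    apply injective_projections; simpl; ring. }
  (* Minimality: with [X] and [Y] harmonic, [<x_{z zbar}, g>] is
     [l_{z zbar} <p, g>]. *)
  assert (Hlap : forall p, Sigma p -> laplacian l p = 0).
  { intros p Hp; pose proof (Hmean p Hp) as H.
    destruct (Hg p Hp) as (_ & Hgp & _).
    set (Q := fun f : C -> R => d_zbar (fun q => d_z (fun r => RtoC (f r)) q) p).
    change ((RtoC (2 * exp (- 2 * sigma p)) *
      (- (Q l * RtoC (Defs.c0 (g p))) + Q X * RtoC (Defs.c1 (g p))
       + Q Y * RtoC (Defs.c2 (g p)) + Q l' * RtoC (Defs.c3 (g p))))%C = RtoC 0)
      in H.
    unfold Q in H.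
    rewrite (d_zbar_d_z_RtoC Sigma l Ho Hl p Hp),
      (d_zbar_d_z_RtoC Sigma X Ho HX p Hp),
      (d_zbar_d_z_RtoC Sigma Y Ho HY p Hp),
      (d_zbar_d_z_RtoC Sigma l' Ho Hl' p Hp) in H.
    destruct (HlapXY p Hp) as [-> ->] in H.
    destruct (Hll p Hp) as (_ & _ & E) in H; rewrite E in H.
    apply (f_equal Re) in H; unfold Re in H; simpl in H.
    unfold lorentz, vec_p in Hgp; simpl in Hgp.
    assert (H' : 2 * exp (- 2 * sigma p) * (/ 4 * laplacian l p
      * (- (Defs.c0 (g p) * 1) + Defs.c3 (g p) * 1)) = 0) by lra.
    replace (- (Defs.c0 (g p) * 1) + Defs.c3 (g p) * 1) with 1 in H' by lra.
    pose proof (exp_pos (- 2 * sigma p)).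
    apply Rmult_integral in H'; lra. }
  assert (Dl : forall p, Sigma p -> exists c,
    @is_derive C_AbsRing C_NormedModule (gradient_form l) p c).
  { intros p Hp; eexists; apply (harmonic_gradient_form Sigma); auto. }
  assert (Dphi : forall p, Sigma p -> exists c,
    @is_derive C_AbsRing C_NormedModule phi p c).
  { intros p Hp; eexists; apply (harmonic_gradient_form Sigma); auto.
    apply HlapXY, Hp. }
  assert (Dh : forall p, Sigma p -> exists c,
    @is_derive C_AbsRing C_NormedModule h p c).
  { intros p Hp; destruct (Dl p Hp) as [a Ha]; destruct (Dphi p Hp) as [b Hb].
    eexists; apply is_derive_Cdiv; eauto. }
  assert (Hgauss : forall p, Sigma p ->
    g p = vscale (- / 2)
            (Vec4 (1 + Cmod (h p) ^ 2) (2 * Re (h p))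
                  (- 2 * Im (h p)) (- 1 + Cmod (h p) ^ 2))).
  { intros p Hp; destruct (Hg p Hp) as (Hlight & Hgp & Hperp).
    apply (lightlike_normal_unique (g p) (d_u l p) (d_v l p)
      (d_u X p) (d_u Y p)); auto.
    - rewrite <- Htu by exact Hp; apply Hperp.
    - rewrite <- Htv by exact Hp; apply Hperp.
    - pose proof (exp_pos (2 * sigma p)) as Hexp.
      rewrite <- Hphi2, Cmod2_alt, HphiE in Hexp by exact Hp; exact Hexp.
    - rewrite <- HphiE by exact Hp; exact (Hhphi p Hp). }
  exists h, phi; repeat split.
  - intros p Hp; left; exists Sigma; repeat split; [exact Ho | exact Hp |].
    exact Dh.
  - exact Dphi.
  - exists (fun q => h q ^ 2 * phi q)%C; split; [|reflexivity].
    intros p Hp; destruct (Dh p Hp) as [a Ha]; destruct (Dphi p Hp) as [b Hb].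
    eexists.
    apply (is_derive_Cmult (fun q => h q ^ 2)%C phi); [|exact Hb].
    apply (is_derive_Cmult h (fun q => h q * 1)%C); [exact Ha|].
    apply (is_derive_Cmult h (fun q => RtoC 1)); [exact Ha|].
    apply @is_derive_const.
  - intros gamma gamma' Hgamma.
    destruct (line_integral_gradient_form _ _ _ _ _ Ho Hl Hhphi Hgamma)
      as (Il & HIl & El).
    destruct (line_integral_gradient_form _ X (fun z => 1 * phi z)%C _ _ Ho HX
      (fun p _ => Cmult_1_l _) Hgamma) as (Ix & HIx & Ex).
    destruct (line_integral_gradient_form _ _ _ _ _ Ho HY HiY Hgamma)
      as (Iy & HIy & Ey).
    exists Il, Ix, Iy; repeat split; auto.
    rewrite El, Ex, Ey.
    assert (E0 : Defs.c3 (x (gamma 0)) = l (gamma 0))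
      by (apply I3_last, HI3, Hgamma; lra).
    assert (E1 : Defs.c3 (x (gamma 1)) = l (gamma 1))
      by (apply I3_last, HI3, Hgamma; lra).
    unfold l, X, Y in *; unfold vadd, I3_point; simpl.
    destruct (x (gamma 1)), (x (gamma 0)); simpl in *; f_equal; lra.
  - intros p w Hp; rewrite Hmetric, Hphi2, Cmod2_alt by exact Hp; reflexivity.
  - intros p Hp.
    destruct (Dphi p Hp) as [a Ha]; destruct (Dh p Hp) as [b Hb].
    rewrite (is_derive_d_z _ _ _ Hb).
    set (Q := fun f : C -> R => d_z (fun q => d_z (fun r => RtoC (f r)) q) p).
    change (hopf_differential x g p) with
      (- (Q l * RtoC (Defs.c0 (g p))) + Q X * RtoC (Defs.c1 (g p))
       + Q Y * RtoC (Defs.c2 (g p)) + Q l' * RtoC (Defs.c3 (g p)))%C.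
    (* The components of [x_z] are the complex functions [h phi / 2],
       [phi / 2], [- i phi / 2] and [h phi / 2] again, whose holomorphic
       derivatives are at hand. *)
    assert (HQ : forall (f : C -> R) (w : C -> C) (c : C),
      (forall q, Sigma q -> gradient_form f q = w q) ->
      @is_derive C_AbsRing C_NormedModule w p c -> Q f = (/ 2 * c)%C).
    { intros f w c Hw Dw; unfold Q.
      rewrite (d_z_ext_loc _ (fun q => / 2 * w q)%C).
      - apply is_derive_d_z.
        replace (/ 2 * c)%C with (RtoC 0 * w p + / 2 * c)%C by ring.
        apply (is_derive_Cmult (fun _ => / 2)%C w); [|exact Dw].
        apply @is_derive_const.
      - generalize (Ho p Hp); apply filter_imp; intros q Hq.
        rewrite d_z_RtoC, Hw by exact Hq; reflexivity. }
    assert (D1 : forall k : C, @is_derive C_AbsRing C_NormedModule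
                   (fun q => k * phi q)%C p (k * a)%C).
    { intros k; replace (k * a)%C with (RtoC 0 * phi p + k * a)%C by ring.
      apply (is_derive_Cmult (fun _ => k) phi); [|exact Ha].
      apply @is_derive_const. }
    pose proof (is_derive_Cmult _ _ _ _ _ Hb Ha) as D2.
    rewrite (HQ l (fun q => h q * phi q)%C _
        (fun q Hq => eq_sym (Hhphi q Hq)) D2),
      (HQ X phi a (fun _ _ => eq_refl) Ha),
      (HQ Y (fun q => - Ci * phi q)%C _
        (fun q Hq => eq_sym (HiY q Hq)) (D1 _)).
    rewrite (HQ l' (fun q => h q * phi q)%C _) with (2 := D2).
    2: { intros q Hq; rewrite Hhphi by exact Hq.
      destruct (Hll q Hq) as (E1 & E2 & _).
      unfold gradient_form; rewrite E1, E2; reflexivity. }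
    rewrite Hgauss by exact Hp; rewrite Cmod2_alt.
    generalize (h p) (phi p); intros hp phip.
    apply injective_projections; unfold Re, Im; simpl; field.
  - exact Hgauss.
Qed.
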